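(* Let $\Phi$ be a balanced relative simplicial complex of dimension $d-1$, and let a finite group $\mathfrak G$ act on $\Phi$. Then \[\mathrm{Hilb}(\Phi,\mathfrak G,\mathbf x)=\sum_{S\subseteq[d]}\Big(\sum_{i=0}^{|S|}(-1)^{|S|-i}\chi_{\widetilde H_{i-1}(\Phi|_S),\mathfrak G}\Big)F_{S,d+1};\] equivalently, for every $S\subseteq[d]$, $h_S(\Phi,\mathfrak G)=\sum_{i=0}^{|S|}(-1)^{|S|-i}\chi_{\widetilde H_{i-1}(\Phi|_S),\mathfrak G}$.
   Context: A balanced relative simplicial complex of dimension $d-1$ on finite vertex set $V$ is a nonempty collection $\Phi$ of subsets of $V$ with $\kappa:V\to[d]$ such that: (i) $\rho\subseteq\sigma\subseteq\tau$, $\rho,\tau\in\Phi$ implies $\sigma\in\Phi$; (ii) every face lies in a face of size $d$; (iii) $\kappa$ is injective on faces. $\kappa(\sigma)=\{\kappa(v):v\in\sigma\}$; $\Phi|_S=\{\sigma\in\Phi:\kappa(\sigma)\subseteq S\}$. A finite group $\mathfrak G$ acts on $\Phi$ if it acts on $V$ with $\kappa(\mathfrak gv)=\kappa(v)$ and $\mathfrak g\sigma\in\Phi$ for $\sigma\in\Phi$. For $S=\{s_1<\dots<s_k\}\subseteq[n-1]$, the monomial quasisymmetric function is $M_{S,n}=\sum_{i_1<\dots<i_{k+1}}\prod_{j=1}^{k+1}x_{i_j}^{s_j-s_{j-1}}$ ($s_0=0$, $s_{k+1}=n$), and the fundamental quasisymmetric function is $F_{S,n}=\sum_{T\supseteq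 S}M_{T,n}$. The flag quasisymmetric class function is $\mathrm{Hilb}(\Phi,\mathfrak G,\mathbf x;\mathfrak g)=\sum_{\sigma\in\Phi,\ \mathfrak g\sigma=\sigma}M_{\kappa(\sigma),d+1}$, and $h_S(\Phi,\mathfrak G)$ is the class function coefficient of $F_{S,d+1}$ in it (equivalently $h_S=\sum_{T\subseteq S}(-1)^{|S\setminus T|}f_T$ where $f_T$ is the permutation character of $\mathfrak G$ on $\{\sigma\in\Phi:\kappa(\sigma)=T\}$). The reduced chain complex of $\Phi|_S$ over $\mathbb C$ has in degree $i$ the basis of faces of $\Phi|_S$ of cardinality $i+1$ (the empty face in degree $-1$ if present), with the simplicial boundary (faces oriented by increasing color) in which faces not in $\Phi|_S$ are omitted; equivalently it is the relative chain complex $\widetilde C(\Delta|_S)/\widetilde C(\Gamma|_S)$ where $\Delta|_S$ is the set of subsets of faces of $\Phi|_S$ and $\Gamma|_S=\Delta|_S\setminus\Phi|_S$. $\mathfrak G$ acts on it by chain maps, hence on $\widetilde H_{i}(\Phi|_S)$; $\chi_{\widetilde H_{i}(\Phi|_S),\mathfrak G}$ denotes the resulting character. *)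

(* Defs.v *)
From mathcomp Require Import all_boot all_order all_fingroup all_algebra.
From mathcomp Require Import mxrepresentation.
From mathcomp Require Import finmap monalg.

Set Implicit Arguments.
Unset Strict Implicit.
Unset Printing Implicit Defensive.

Import Order.TTheory GRing.Theory Num.Theory.

Local Open Scope ring_scope.

(* The color set [d] = {1, ..., d} is 'I_d, the ordinal i standing for i + 1.
   The variables x_1, x_2, ... are indexed by nat; only their order matters. A
   formal power series is given by its coefficients, indexed by the monomials
   {cmonom nat}. *)

Section QuasiSymmetric.

Variables (R : pzSemiRingType) (d : nat).
Implicit Types (S T : {set 'I_d}) (m : {cmonom nat}).

(* s_0 = 0 < s_1 < ... < s_k < s_(k+1) = d + 1, for S = {s_1 < ... < s_k};
   enum lists the elements of S in increasing order. *)
Definition breakpoints S : seq nat :=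
  0%N :: rcons [seq (val i).+1 | i <- enum S] d.+1.

Definition gap S (j : nat) : nat :=
  (nth 0 (breakpoints S) j.+1 - nth 0 (breakpoints S) j)%N.

Definition index_monomial S (i : 'I_#|S|.+1 -> nat) : {cmonom nat} :=
  \big[@mmul _/@mone _]_(j < #|S|.+1) expcmn (ucm (i j)) (gap S j).

(* The coefficient of m in M_{S,d+1}: the number of index sequences
   i_1 < ... < i_(k+1) whose monomial is m. As all the exponents are positive,
   the indices of such a sequence lie in the support of m, so that the infinite
   sum restricts to a finite one. *)
Definition monomial_qsym S m : R :=
  #|[set i : {ffun 'I_#|S|.+1 -> finsupp m} |
      [forall j : 'I_#|S|.+1, forall k : 'I_#|S|.+1, (j < k)%N ==> (val (i j) < val (i k))%N]
      && (index_monomial (fun j => val (i j)) == m)]|%:R.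

Definition fundamental_qsym S m : R :=
  \sum_(T : {set 'I_d} | S \subset T) monomial_qsym T m.

End QuasiSymmetric.

Section RelativeComplex.

Variables (d : nat) (V : finType) (kappa : V -> 'I_d) (Phi : {set {set V}}).

Record balanced_relative_complex : Prop := BalancedRelativeComplex {
  brc_nonempty : Phi != set0;
  brc_convex : forall rho sigma tau : {set V}, rho \in Phi -> tau \in Phi ->
    rho \subset sigma -> sigma \subset tau -> sigma \in Phi;
  brc_pure : forall sigma, sigma \in Phi ->
    exists tau, [/\ tau \in Phi, sigma \subset tau & #|tau| = d];
  brc_balanced : forall sigma, sigma \in Phi -> {in sigma &, injective kappa}
}.

Definition color_set (sigma : {set V}) : {set 'I_d} := kappa @: sigma.

Definition restriction (S : {set 'I_d}) : {set {set V}} :=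
  [set sigma in Phi | color_set sigma \subset S].

Definition sized_faces (S : {set 'I_d}) (k : nat) : {set {set V}} :=
  [set sigma in restriction S | #|sigma| == k].

Definition face S k (a : 'I_#|sized_faces S k|) : {set V} := enum_val a.

Lemma face_inj {S k} : injective (@face S k).
Proof. exact: enum_val_inj. Qed.

Lemma faceP S k (a : 'I_#|sized_faces S k|) : face a \in sized_faces S k.
Proof. exact: enum_valP. Qed.

Lemma faceK S k sigma : sigma \in sized_faces S k ->
  exists a : 'I_#|sized_faces S k|, face a = sigma.
Proof. by move=> Fs; exists (enum_rank_in Fs sigma); apply: enum_rankK_in. Qed.

(* The matrix, acting on row vectors, of the boundary from the chains on faces
   of cardinality k (degree k - 1) to those on faces of cardinality k.-1. Faces
   are oriented by increasing color, hence the sign, and the facets that are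
   not in Phi|_S are dropped. For k = 0 the target should be 0; this is the
   zero matrix, since the empty face has no vertex. *)
Definition boundary_mx (F : fieldType) (S : {set 'I_d}) (k : nat) :
    'M[F]_(#|sized_faces S k|, #|sized_faces S k.-1|) :=
  \matrix_(a, b)
    \sum_(v in face a | face a :\ v == face b)
      (-1) ^+ #|[set w in face a | (kappa w < kappa v)%N]|.

Definition cycles_mx (F : fieldType) S k : 'M[F]_#|sized_faces S k| :=
  kermx (boundary_mx F S k).

Definition boundaries_mx (F : fieldType) S k : 'M[F]_#|sized_faces S k| :=
  <<boundary_mx F S k.+1>>%MS.

Section GroupAction.

Variables (gT : finGroupType) (G : {group gT}) (to : action G V).

Record acts_on_complex : Prop := ActsOnComplex {
  aoc_color : forall g v, g \in G -> kappa (to v g) = kappa v;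
  aoc_face : forall g sigma, g \in G -> sigma \in Phi ->
    (to^*)%act sigma g \in Phi
}.

(* The coefficients of Hilb(Phi, G, x; g) *)
Definition flag_hilb (R : pzSemiRingType) (g : gT) (m : {cmonom nat}) : R :=
  \sum_(sigma in Phi | (to^*)%act sigma g == sigma)
    monomial_qsym R (color_set sigma) m.

(* The value at g of the permutation character f_T *)
Definition flag_f (T : {set 'I_d}) (g : gT) : nat :=
  #|[set sigma in Phi | (color_set sigma == T)
                        && ((to^*)%act sigma g == sigma)]|.

Definition flag_h (R : pzRingType) (S : {set 'I_d}) (g : gT) : R :=
  \sum_(T : {set 'I_d} | T \subset S) (-1) ^+ #|S :\: T| * (flag_f T g)%:R.

Hypothesis actPhi : acts_on_complex.

Variables (F : fieldType) (S : {set 'I_d}).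

Lemma color_set_act g sigma : g \in G ->
  color_set ((to^*)%act sigma g) = color_set sigma.
Proof.
move=> Gg; rewrite /color_set /= /setact -imset_comp.
by apply: eq_imset => v /=; rewrite (aoc_color actPhi).
Qed.

Lemma card_act g sigma : #|(to^*)%act sigma g| = #|sigma|.
Proof. by rewrite /= /setact card_imset //; apply: act_inj. Qed.

Lemma sized_faces_act k g sigma : g \in G ->
  sigma \in sized_faces S k -> (to^*)%act sigma g \in sized_faces S k.
Proof.
move=> Gg; rewrite !inE color_set_act // card_act.
by case/andP=> /andP[/(aoc_face actPhi Gg) -> ->] ->.
Qed.

(* MathComp groups act on the right, on vertices as on row vectors: g sends the
   basis vector of sigma to that of its image. *)
Definition chain_mx k (g : gT) : 'M[F]_#|sized_faces S k| :=
  \matrix_(a, b) ((to^*)%act (face a) g == face b)%:R.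

Lemma mul_chain_mx k n (A : 'M[F]_(#|sized_faces S k|, n)) g a c :
  g \in G -> (chain_mx k g *m A) a c =
    \sum_(b | (to^*)%act (face a) g == face b) A b c.
Proof.
move=> Gg; rewrite mxE [RHS]big_mkcond; apply: eq_bigr => b _.
by rewrite mxE; case: eqP => _; rewrite ?mul1r ?mul0r.
Qed.

Lemma mul_chain_mx_row k n (A : 'M[F]_(#|sized_faces S k|, n)) g a b c :
  g \in G -> (to^*)%act (face a) g = face b ->
  (chain_mx k g *m A) a c = A b c.
Proof.
move=> Gg Eb; rewrite mul_chain_mx // (big_pred1 b) // => b'.
by rewrite Eb (inj_eq face_inj) eq_sym.
Qed.

Lemma chain_mx_repr k : mx_repr G (chain_mx k).
Proof.
split=> [|g h Gg Gh].
  by apply/matrixP=> a b; rewrite !mxE act1 (inj_eq face_inj).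
apply/matrixP=> a c.
have [a' Ea] := faceK (sized_faces_act Gg (faceP a)).
rewrite (mul_chain_mx_row _ _ Gg (esym Ea)).
by rewrite !mxE Ea actMin.
Qed.

Definition chain_repr k := MxRepresentation (chain_mx_repr k).

Lemma chain_mx_boundary k g : g \in G ->
  chain_mx k g *m boundary_mx F S k = boundary_mx F S k *m chain_mx k.-1 g.
Proof.
move=> Gg; apply/matrixP=> a c.
have [a' Ea] := faceK (sized_faces_act Gg (faceP a)).
rewrite (mul_chain_mx_row _ _ Gg (esym Ea)).
have Gg' : g^-1%g \in G by rewrite groupV.
have [b Eb] := faceK (sized_faces_act Gg' (faceP c)).
rewrite [RHS]mxE (bigD1 b) //= big1 => [|b' b'b]; last first.
  rewrite [chain_mx _ _ _ _]mxE; case: eqP => [Eb'|]; last by rewrite mulr0.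
  case/eqP: b'b; apply: face_inj; rewrite Eb -Eb'.
  by rewrite -[RHS]/((to^*)%act _ _) actKin.
rewrite addr0 [chain_mx _ _ _ _]mxE {1}Eb actKVin // eqxx mulr1.
rewrite !mxE Ea /=.
rewrite (reindex_inj (act_inj to g)) /=.
apply: eq_big => [v|v _].
  rewrite {1}/setact (mem_imset _ _ (act_inj to g)) Eb; congr (_ && _).
  have -> : setact to (face a) g :\ to v g = (to^*)%act (face a :\ v) g.
    apply/setP=> w; rewrite /= /setact in_setD1.
    apply/andP/imsetP=> [[vw /imsetP[u au Ew]]|[u]].
      by exists u; rewrite // in_setD1 au andbT; apply: contraNneq vw => <-;
        rewrite Ew.
    rewrite in_setD1 => /andP[uv au] ->.
    by rewrite (inj_eq (act_inj to g)) uv; split=> //; apply/imsetP; exists u.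
  by rewrite -[in LHS](actKVin (to^*)%act Gg (face c)) (inj_eq (act_inj _ _)).
congr (_ ^+ _); rewrite -[RHS](card_imset _ (act_inj to g)).
apply: eq_card => w; rewrite inE; apply/andP/imsetP.
  case=> /imsetP[u au ->]; rewrite !(aoc_color actPhi) // => ltuv.
  by exists u; rewrite // inE au.
case=> u; rewrite inE => /andP[au ltuv] ->.
rewrite !(aoc_color actPhi) //; split=> //; rewrite /setact.
by apply/imsetP; exists u.
Qed.

Lemma cycles_module k : mxmodule (chain_repr k) (cycles_mx F S k).
Proof.
apply/mxmoduleP=> g Gg; apply/sub_kermxP.
by rewrite -mulmxA chain_mx_boundary // mulmxA mulmx_ker mul0mx.
Qed.

Lemma boundaries_module k : mxmodule (chain_repr k) (boundaries_mx F S k).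
Proof.
apply/mxmoduleP=> g Gg; rewrite /boundaries_mx.
rewrite (eqmxMr _ (genmxE _)) genmxE /=.
by rewrite -(chain_mx_boundary k.+1 Gg) submxMl.
Qed.

(* The representation of G on the quotient of cycles by boundaries, i.e. on
   the reduced homology of Phi|_S in degree k - 1 *)
Definition homology_repr k :=
  section_repr (boundaries_module k) (cycles_module k).

Definition homology_char k (g : gT) : F := \tr (homology_repr k g).

End GroupAction.

End RelativeComplex.

(* Main.v *)
(** Taking traces along B_k <= Z_k <= C_k, with C_k / Z_k isomorphic to B_(k-1)
    through the boundary map, gives tr C_k = tr B_k + tr H_(k-1) + tr B_(k-1);
    the boundary terms telescope, and the trace on C_k counts the fixed faces
    of size k, so the alternating sum of the homology characters is h_S.
    Moebius inversion over the subsets of [d] then converts between the M and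
    the F expansions of the flag quasisymmetric function. The coefficients h_S
    are unique since the M_T are linearly independent: T can be read off from
    the partial degrees of any monomial of M_T. *)

Require Import Defs.
From mathcomp Require Import all_boot all_order all_fingroup all_algebra.
From mathcomp Require Import mxrepresentation.
From mathcomp Require Import finmap monalg.
From mathcomp Require Import ring.

Set Implicit Arguments.
Unset Strict Implicit.
Unset Printing Implicit Defensive.

Import Order.TTheory GRing.Theory Num.Theory.

Local Open Scope ring_scope.

(** * Moebius inversion on the lattice of subsets *)

Section Moebius.

Variables (I : finType) (R : pzRingType).
Implicit Types (S T U : {set I}) (f h : {set I} -> R).

(** When [U] is properly contained in [T], toggling a fixed element of [T] outside [U] pairs the
    sets of the interval with opposite signs. *)
Lemma sum_interval_sign U T : U \subset T ->
  \sum_(S : {set I} | (U \subset S) && (S \subset T)) (-1) ^+ #|S :\: U|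
    = (U == T)%:R :> R.
Proof.
move=> sUT; have [<-|/eqP neUT] := eqVneq.
  rewrite (big_pred1 U) ?setDv ?cards0 // => S.
  by rewrite [RHS]eqEsubset andbC.
have [x xT xU] : exists2 x, x \in T & x \notin U.
  by apply/subsetPn; apply: contra_notN neUT => sTU; apply/eqP; rewrite eqEsubset sUT.
rewrite (bigID (fun S => x \in S)) /=.
(* The sets containing [x] are reindexed by those omitting it, so that the two halves can be added
   termwise. *)
rewrite (reindex_onto (fun S => x |: S) (fun S => S :\ x)) /=; last first.
  by move=> S /andP[_ xS]; rewrite setD1K.
rewrite [X in X + _](eq_bigl (fun S => (U \subset S) && (S \subset T) && (x \notin S))).
  rewrite -big_split big1 //= => S /andP[_ xS].
  rewrite setDUl (_ : [set x] :\: U = [set x]).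
    rewrite cardsU1 !inE (negPf xS) andbF exprS mulN1r addNr //.
  by apply/setP=> y; rewrite !inE andbC; case: eqP => // ->.
move=> S; rewrite setU11 andbT subUset sub1set xT /=.
have [xS|xS] := boolP (x \in S).
  rewrite !andbF (_ : (_ == S) = false) ?andbF //.
  by apply/negP=> /eqP E; move: xS; rewrite -E !inE eqxx.
rewrite setU1K // eqxx !andbT; congr (_ && _).
by rewrite -subDset (_ : U :\: [set x] = U) //; apply/setDidPl; rewrite disjoint_sym disjoints1.
Qed.

Lemma sum_moebius f T :
  \sum_(S : {set I} | S \subset T)
     \sum_(U : {set I} | U \subset S) (-1) ^+ #|S :\: U| * f U = f T.
Proof.
rewrite (exchange_big_dep (fun U => U \subset T)) /=; last first.
  by move=> S U sST sUS; apply: subset_trans sST.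
have sumE U : U \subset T ->
    \sum_(S : {set I} | (S \subset T) && (U \subset S)) (-1) ^+ #|S :\: U| * f U
    = (U == T)%:R * f U.
  move=> sUT; rewrite -big_distrl /= -(sum_interval_sign sUT); congr (_ * _).
  by apply: eq_bigl => S; rewrite andbC.
rewrite (bigD1 T) //= sumE // eqxx mul1r big1 ?addr0 // => U /andP[sUT neUT].
by rewrite sumE // (negPf neUT) mul0r.
Qed.

(** By strong induction on the size of [T], the terms of proper subsets agree and cancel, leaving
    those of [T]. *)
Lemma sum_subsets_inj f h :
  (forall T, \sum_(S : {set I} | S \subset T) f S =
             \sum_(S : {set I} | S \subset T) h S) ->
  f =1 h.
Proof.
move=> eq_sum T; have [n] := ubnP #|T|; elim: n T => // n IHn T ltTn.
have := eq_sum T; rewrite (bigD1 T) //= [in RHS](bigD1 T) //=.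
rewrite (eq_bigr h) => [/addIr //|S]; rewrite andbC -properEneq => prST.
by apply: IHn; apply: leq_trans (proper_card prST) ltTn.
Qed.

End Moebius.

(** * Flag numbers and the change between the M and F expansions *)

Section FlagNumbers.

Variables (R : pzRingType) (d : nat) (V : finType) (kappa : V -> 'I_d).
Variable Phi : {set {set V}}.
Variables (gT : finGroupType) (G : {group gT}) (to : action G V).

Local Notation fixed g s := ((to^*)%act s g == s).

(** Fixed faces are grouped by color set. Taking [f] to be the monomial functions gives Hilb; taking
    it to be signs gives [flag_h]. *)
Lemma sum_flag_f g (f : {set 'I_d} -> R) (P : pred {set 'I_d}) :
  \sum_(T | P T) f T * (flag_f kappa Phi to T g)%:R
  = \sum_(s in Phi | fixed g s && P (color_set kappa s)) f (color_set kappa s).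
Proof.
rewrite [RHS](partition_big (color_set kappa) P); last by move=> s /and3P[].
apply: eq_bigr => T PT.
rewrite (eq_bigr (fun _ => f T)) => [|s /andP[_ /eqP->] //].
rewrite sumr_const mulr_natr; congr (_ *+ _).
rewrite /flag_f cardsE; apply: eq_card => s; rewrite !unfold_in /=.
by case: eqP => [->|]; rewrite ?PT ?andbT ?andbF.
Qed.

Lemma flag_hilbE g (m : {cmonom nat}) :
  flag_hilb kappa Phi to R g m =
  \sum_(T : {set 'I_d}) (flag_f kappa Phi to T g)%:R * monomial_qsym R T m.
Proof.
transitivity (\sum_(T : {set 'I_d}) monomial_qsym R T m * (flag_f kappa Phi to T g)%:R).
  by rewrite sum_flag_f; apply: eq_bigl => s; rewrite andbT.
by apply: eq_bigr => T _; rewrite mulr_natr mulr_natl.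
Qed.

End FlagNumbers.

Lemma sum_fundamental_qsym (R : pzSemiRingType) d (h : {set 'I_d} -> R) m :
  \sum_(S : {set 'I_d}) h S * fundamental_qsym R S m =
  \sum_(T : {set 'I_d}) (\sum_(S : {set 'I_d} | S \subset T) h S) * monomial_qsym R T m.
Proof.
under eq_bigr => S _ do rewrite big_distrr /=.
rewrite (exchange_big_dep xpredT) //=.
by apply: eq_bigr => T _; rewrite big_distrl.
Qed.

(** * Representations on quotients and images *)

Lemma val_in_factmodM (F : fieldType) m n p (U : 'M[F]_n) (f : 'M[F]_(n, p))
    (W : 'M[F]_(m, n)) :
  U *m f = 0 -> val_factmod (in_factmod U W) *m f = W *m f.
Proof.
move=> Uf0; rewrite -[in RHS](add_sub_fact_mod U W) mulmxDl.
have /submxP[A ->] := val_submodP (in_submod U W).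
by rewrite -mulmxA Uf0 mulmx0 add0r.
Qed.

(** The equivariant first isomorphism theorem: source modulo kernel is similar to the image. *)
Lemma mx_rsim_coimage (F : fieldType) (gT : finGroupType) (G : {group gT})
    n1 n2 (rG1 : mx_representation F G n1) (rG2 : mx_representation F G n2)
    (f : 'M[F]_(n1, n2)) U V (modU : mxmodule rG1 U) (modV : mxmodule rG2 V) :
  (forall g, g \in G -> rG1 g *m f = f *m rG2 g) ->
  (U :=: kermx f)%MS -> (V :=: f)%MS ->
  mx_rsim (factmod_repr modU) (submod_repr modV).
Proof.
move=> fJ kerU imV.
have Uf0 m (W : 'M_(m, n1)) : (W <= U)%MS = (W *m f == 0).
  by rewrite kerU; apply/sub_kermxP/eqP.
have sfV m (W : 'M_(m, n1)) : (W *m f <= V)%MS by rewrite imV submxMl.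
have mulE m (W : 'M_(m, \rank (cokermx U))) :
    W *m in_submod V (val_factmod 1%:M *m f) = in_submod V (val_factmod W *m f).
  by rewrite /in_submod /val_factmod /= !mulmxA mulmx1.
(* The intertwiner lifts a class, applies [f], and takes coordinates in [V]. The dimensions agree by
   rank-nullity. *)
exists (in_submod V (val_factmod 1%:M *m f)) => [||g Gg].
- by rewrite mxrank_coker kerU imV mxrank_ker subKn // rank_leq_row.
- rewrite -kermx_eq0; apply/rowV0P=> u /sub_kermxP; rewrite mulE => u0.
  have : (val_factmod u <= U)%MS by rewrite Uf0 -(in_submodK (sfV _ _)) u0 linear0.
  by rewrite -in_factmod_eq0 val_factmodK => /eqP.
rewrite mulE -in_submodJ // -[_ *m f *m _]mulmxA -fJ // mulmxA.
by rewrite /= /factmod_mx val_in_factmodM //; apply/eqP; rewrite -Uf0.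
Qed.

Lemma mxtrace_rank0 (F : fieldType) (gT : finGroupType) (G : {group gT})
    n (rG : mx_representation F G n) U (modU : mxmodule rG U) g :
  U = 0 -> \tr (submod_repr modU g) = 0.
Proof.
move=> U0; rewrite /mxtrace big1 // => i.
by exfalso; case: i => i; rewrite U0 mxrank0.
Qed.

(** * The relative chain complex and traces on its homology *)

Section Homology.

Variables (F : fieldType) (d : nat) (V : finType) (kappa : V -> 'I_d).
Variable Phi : {set {set V}}.
Hypothesis balPhi : balanced_relative_complex kappa Phi.
Variable S : {set 'I_d}.

Local Notation faces := (sized_faces kappa Phi S).
Local Notation boundary := (boundary_mx kappa Phi F S).

(** The exponent of the boundary sign attached to removing [v] from [s]. *)
Definition rank_in (s : {set V}) (v : V) : nat :=
  #|[set w in s | (kappa w < kappa v)%N]|.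

Lemma rank_inD1 (s : {set V}) v w : v \in s ->
    rank_in s w = ((kappa v < kappa w) + rank_in (s :\ v) w)%N.
Proof.
move=> sv; rewrite /rank_in (cardsD1 v) inE sv /=; congr (_ + _)%N.
by apply: eq_card => u; rewrite !inE andbA.
Qed.

Lemma boundary_mx0 : boundary 0 = 0.
Proof.
apply/matrixP=> a b; rewrite !mxE big1 // => v /andP[av _].
by have := faceP a; rewrite inE => /andP[_]; rewrite (cardsD1 v) av.
Qed.

Lemma sized_faces_gt k : (#|S| < k)%N -> faces k = set0.
Proof.
move=> ltSk; apply/setP=> s; rewrite !inE; apply/negP=> /andP[/andP[Ps sS] /eqP sk].
have := subset_leq_card sS; rewrite card_in_imset; last exact: (brc_balanced balPhi).
by rewrite sk leqNgt ltSk.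
Qed.

Lemma boundary_gt k : (#|S| < k)%N -> boundary k = 0.
Proof.
move=> ltSk; apply/matrixP=> a; exfalso; have := faceP a.
by rewrite sized_faces_gt // inE.
Qed.

(* The facets dropped from the relative boundary contribute nothing: by
   convexity, a set between two faces is a face. The two orders of removing a
   pair of vertices then cancel. *)
Lemma boundaryM0 k : boundary k.+1 *m boundary k = 0.
Proof.
apply/matrixP=> a c; rewrite !mxE.
have := faceP a; have := faceP c; set A := face a; set C := face c.
rewrite !inE => /andP[/andP[PC CS] _] /andP[/andP[PA AS] /eqP cardA].
(* [D] collects the ordered pairs of vertices whose successive removal leads from [A] to [C]; [f] is
   the sign of such a pair. *)
pose D (p : V * V) := [&& p.1 \in A, p.2 \in A :\ p.1 & A :\ p.1 :\ p.2 == C].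
pose f p : F := (-1) ^+ (rank_in A p.1 + rank_in (A :\ p.1) p.2).
transitivity (\sum_(p | D p) f p).
  under eq_bigr => b _.
    rewrite !mxE big_distrl /=.
    under eq_bigr => v _.
      rewrite big_distrr /=; over.
    over.
  rewrite [LHS](exchange_big_dep (mem A)) /=; last by move=> b v _ /andP[].
  rewrite (eq_bigl (fun p : V * V =>
      (p.1 \in A) && ((p.2 \in A :\ p.1) && (A :\ p.1 :\ p.2 == C)))) //.
  rewrite -(pair_big_dep (mem A)
      (fun v w => (w \in A :\ v) && (A :\ v :\ w == C)) (fun v w => f (v, w))) /=.
  apply: eq_bigr => v Av.
  have [Pv|nPv] := boolP (A :\ v \in faces k).
    have [b Eb] := faceK Pv.
    rewrite (big_pred1 b) => [|b']; last first.
      by rewrite [v \in _]Av -Eb (inj_eq (@face_inj _ _ _ _ _ _)) eq_sym.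
    by rewrite Eb; apply: eq_bigr => w _; rewrite -exprD.
  rewrite big1 => [|b /andP[_ /eqP Eb]]; last by rewrite Eb faceP in nPv.
  rewrite big1 // => w /andP[Avw /eqP EC]; case/negP: nPv.
  have sCv : C \subset A :\ v by rewrite -EC subsetDl.
  rewrite !inE (brc_convex balPhi PC PA sCv (subsetDl _ _)) /=.
  rewrite (subset_trans (imsetS _ (subsetDl _ _)) AS) /=.
  by move: cardA; rewrite (cardsD1 v) Av add1n => /succn_inj->.
(* Distinct vertices of [A] have distinct colors, so swapping the pair exchanges the two halves of
   this split. *)
rewrite (bigID (fun p : V * V => (kappa p.1 < kappa p.2)%N)) /=.
have swapK : involutive (fun p : V * V => (p.2, p.1)) by case.
rewrite [X in _ + X](reindex_inj (inv_inj swapK)) /=.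
have kI v w : v \in A -> w \in A -> kappa v = kappa w -> v = w.
  exact: (brc_balanced balPhi PA).
have swapD p : (D (p.2, p.1) && ~~ (kappa p.2 < kappa p.1)%N)
    = (D p && (kappa p.1 < kappa p.2)%N).
  case: p => v w; rewrite /D /= setDDl [w |: _]setUC -setDDl !inE.
  have [->|vw] := eqVneq v w; first by rewrite !andbF.
  rewrite /= andbCA; case: (boolP (v \in A)) => //= Av.
  case: (boolP (w \in A)) => //= Aw; congr (_ && _).
  rewrite -leqNgt leq_eqVlt (inj_eq val_inj); case: eqP => //= Ek.
  by case/eqP: vw; apply: kI.
rewrite (eq_bigl _ _ swapD) -big_split big1 //= => -[v w].
rewrite /D /= => /andP[/and3P[Av Aw _] ltvw].
have [wv {}Aw] := setD1P Aw.
(* Only removing the vertex of smaller color shifts the rank of the other, so the two exponents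
   differ by one. *)
rewrite /f /= (rank_inD1 w Av) (rank_inD1 v Aw).
rewrite ltvw [(kappa w < _)%N]ltnNge (ltnW ltvw) /= add0n -addnA.
by rewrite [in X in X + _]addnC exprS mulN1r subrr.
Qed.

Section Action.

Variables (gT : finGroupType) (G : {group gT}) (to : action G V).
Hypothesis actPhi : acts_on_complex kappa Phi to.

Local Notation fixed g s := ((to^*)%act s g == s).
Local Notation chain := (chain_repr actPhi F S).

(* Indexed so that [image_module k.+1] is [boundaries_module k]. *)
Lemma image_module k : mxmodule (chain k.-1) <<boundary k>>%MS.
Proof.
apply/mxmoduleP=> g Gg; rewrite (eqmxMr _ (genmxE _)) genmxE /=.
by rewrite -(chain_mx_boundary actPhi _ _ _ Gg) submxMl.
Qed.

Definition image_char k g : F := \tr (submod_repr (image_module k) g).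

Lemma image_char_eq0 k g : boundary k = 0 -> image_char k g = 0.
Proof. by move=> D0; apply: mxtrace_rank0; rewrite D0 genmx0. Qed.

Lemma chain_char k g : g \in G ->
  \tr (chain k g) =
    image_char k.+1 g + homology_char actPhi F S k g + image_char k g.
Proof.
move=> Gg; set modB := boundaries_module actPhi F S k.
set modZ := cycles_module actPhi F S k.
(* Splitting off B_k and then Z_k / B_k leaves (C_k / B_k) / (Z_k / B_k), to be compared with the
   image of the boundary. *)
rewrite -(mxtrace_sub_fact_mod modB) -(mxtrace_sub_fact_mod (section_module modB modZ)).
rewrite addrA; congr (_ + _ + _).
apply: mxtrace_rsim Gg.
have B0 : boundaries_mx kappa Phi F S k *m boundary k = 0.
  by apply/sub_kermxP; rewrite genmxE; apply/sub_kermxP/boundaryM0.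
have val1M m (W : 'M_(m, _)) :
    W *m (val_factmod 1%:M *m boundary k) = val_factmod W *m boundary k.
  by rewrite /val_factmod /= !mulmxA mulmx1.
(* This is the map that the boundary induces on C_k / B_k, well defined by [B0]. *)
apply: (mx_rsim_coimage (f := val_factmod 1%:M *m boundary k)).
- move=> h Gh; rewrite val1M [factmod_repr modB h]/(factmod_mx modB h).
  rewrite /factmod_mx val_in_factmodM // -[LHS]mulmxA -[RHS]mulmxA; congr (_ *m _).
  exact: (chain_mx_boundary actPhi _ _ _ Gh).
- apply/eqmxP; rewrite !genmxE; apply/andP; split.
    apply/sub_kermxP; rewrite val1M val_in_factmodM //; exact: mulmx_ker.
  set K := kermx _; rewrite -[K](@val_factmodK _ _ (boundaries_mx kappa Phi F S k)).
  apply: submxMr; apply/sub_kermxP.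
  by rewrite -val1M mulmx_ker.
apply/eqmxP; rewrite !genmxE submxMl andbT.
by rewrite -[X in (X <= _)%MS]mul1mx -(val_in_factmodM 1%:M B0) -val1M submxMl.
Qed.

Lemma alternating_homology g : g \in G ->
  \sum_(i < #|S|.+1) (-1) ^+ (#|S| - i) * homology_char actPhi F S i g =
  \sum_(i < #|S|.+1) (-1) ^+ (#|S| - i) * \tr (chain i g).
Proof.
move=> Gg.
(* Since consecutive signs are opposite, the two image traces in degree [i] contribute
   [e i.+1 - e i]. *)
pose e i := (-1) ^+ (#|S| - i) * image_char i g.
transitivity (\sum_(i < #|S|.+1) (-1) ^+ (#|S| - i) * \tr (chain i g)
   + \sum_(i < #|S|.+1) (e i.+1 - e i)); last first.
  (* Both ends vanish: no face has more than [#|S|] vertices, and the empty face has zero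
     boundary. *)
  rewrite -(big_mkord xpredT (fun i => e i.+1 - e i)) telescope_sumr //.
  rewrite /e !image_char_eq0 ?boundary_mx0 ?boundary_gt ?leqnn //.
  by rewrite !mulr0 subrr addr0.
rewrite -big_split /=; apply: eq_bigr => i _; rewrite chain_char // /e.
have [lti|leSi] := ltnP i #|S|; first by rewrite -(subnSK lti) exprS; ring.
(* In top degree truncated subtraction fails to flip the sign, but the affected trace is zero. *)
by rewrite [image_char i.+1 g]image_char_eq0 ?boundary_gt ?ltnS //; ring.
Qed.

(** The diagonal of the permutation matrix of [g] marks the fixed faces, and a face with [i]
    vertices has exactly [i] colors, which matches the signs. *)
Lemma sum_chain_char g :
  \sum_(i < #|S|.+1) (-1) ^+ (#|S| - i) * \tr (chain i g) =
  flag_h kappa Phi to F S g.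
Proof.
rewrite /flag_h sum_flag_f.
have cardS s : s \in restriction kappa Phi S -> (#|s| < #|S|.+1)%N.
  rewrite inE ltnS => /andP[Ps /subset_leq_card].
  by rewrite card_in_imset //; apply: (brc_balanced balPhi).
(* [inord] loses nothing here, by the size bound [cardS]. *)
rewrite [RHS](partition_big (fun s : {set V} => inord #|s| : 'I_#|S|.+1) xpredT) //=.
apply: eq_bigr => i _; rewrite /mxtrace big_distrr /=.
transitivity
  (\sum_(s in faces i) (-1) ^+ (#|S| - i) * (fixed g s)%:R : F).
  by rewrite [RHS]big_enum_val; apply: eq_bigr => a _; rewrite mxE.
rewrite big_mkcond [RHS]big_mkcond; apply: eq_bigr => s _.
rewrite [s \in sized_faces _ _ _ _]inE.
have [sS|nsS] := boolP (s \in restriction kappa Phi S); last first.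
  by move: nsS; rewrite inE /=; case: (s \in Phi); case: (_ \subset _) => //; rewrite ?andbF.
have -> : (inord #|s| == i :> 'I_#|S|.+1) = (#|s| == i).
  by rewrite -val_eqE /= inordK ?cardS.
move: (sS); rewrite inE => /andP[Ps sSS]; rewrite Ps sSS /= andbT.
case: (eqVneq #|s| i) => [Esi|]; last by rewrite andbF.
rewrite andbT; case: eqP => _; rewrite ?mulr1 ?mulr0 // -Esi cardsD (setIidPr sSS).
rewrite card_in_imset //; exact: (brc_balanced balPhi).
Qed.

End Action.

End Homology.

(** * Linear independence of the monomial quasisymmetric functions *)

Section Breakpoints.

Variable d : nat.
Implicit Types S T : {set 'I_d}.

Lemma size_breakpoints S : size (breakpoints S) = #|S|.+2.
Proof. by rewrite /= size_rcons size_map cardE. Qed.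

Lemma breakpoints_sorted S : sorted ltn (breakpoints S).
Proof.
rewrite (sorted_pairwise ltn_trans) /= pairwise_rcons all_rcons /= !all_map.
apply/and3P; split.
- by apply/allP=> i _ /=.
- by apply/allP=> i _ /=; rewrite ltnS ltn_ord.
rewrite pairwise_map; apply: pairwise_filter.
have : pairwise ltn (map val (enum 'I_d)).
  by rewrite val_enum_ord -(sorted_pairwise ltn_trans) iota_ltn_sorted.
by rewrite pairwise_map enumT.
Qed.

Lemma gap_gt0 S j : (j <= #|S|)%N -> (0 < gap S j)%N.
Proof.
move=> leSj; rewrite subn_gt0.
have := breakpoints_sorted S; move/(sortedP 0%N); apply.
by rewrite size_breakpoints !ltnS.
Qed.

Lemma mem_breakpoints S (s : 'I_d) : (s.+1 \in breakpoints S) = (s \in S).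
Proof.
rewrite inE mem_rcons inE eqSS (ltn_eqF (ltn_ord s)) /=.
apply/mapP/idP=> [[i]|Ss]; last by exists s; rewrite ?mem_enum.
by rewrite mem_enum => Si [/val_inj->].
Qed.

Lemma sum_gap S p : (p <= #|S|.+1)%N ->
  (\sum_(j < #|S|.+1 | (j < p)%N) gap S j = nth 0 (breakpoints S) p)%N.
Proof.
move=> leSp; rewrite -(big_ord_widen _ (gap S) leSp) -(big_mkord xpredT).
rewrite telescope_sumn_in ?subn0 // => j /andP[_ ltjp].
by apply: ltnW; rewrite -subn_gt0; apply: gap_gt0; rewrite -ltnS (leq_trans ltjp).
Qed.

Lemma index_monomialE S (i : 'I_#|S|.+1 -> nat) n :
  index_monomial i n = (\sum_(j < #|S|.+1) (i j == n) * gap S j)%N.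
Proof.
rewrite /index_monomial (big_morph (fun m : {cmonom nat} => m n) (id1 := 0%N) (op1 := addn)).
- apply: eq_bigr => j _; elim: (gap S j) => [|k IHk]; first by rewrite onecmE muln0.
  (* [expcmn] iterates without a trailing unit, so only exponent one needs an argument. *)
  have -> : expcmn (ucm (i j)) k.+1 = mulcm (ucm (i j)) (expcmn (ucm (i j)) k).
    rewrite /expcmn; case: k {IHk} => //=; apply/eqP/cmP => u.
    by rewrite mulcmE onecmE addn0.
  by rewrite mulcmE IHk ucmE mulnS.
- by move=> m1 m2; rewrite cmM.
exact: cm1.
Qed.

Lemma sum_index_monomial S (i : 'I_#|S|.+1 -> nat) N :
  (\sum_(n < N) index_monomial i n =
   \sum_(j < #|S|.+1 | (i j < N)%N) gap S j)%N.
Proof.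
under eq_bigr => n _ do rewrite index_monomialE.
rewrite exchange_big /= [RHS]big_mkcond /=; apply: eq_bigr => j _.
case: (ltnP (i j) N) => [ltN|leN].
  rewrite (bigD1 (Ordinal ltN)) //= eqxx mul1n big1 ?addn0 // => n neq.
  by case: eqP => // Ej; case/eqP: neq; apply: val_inj.
rewrite big1 // => n _; case: eqP => // Ej.
by move: leN; rewrite Ej leqNgt ltn_ord.
Qed.

Definition increasing n (i : 'I_n -> nat) :=
  forall j k : 'I_n, (j < k)%N -> (i j < i k)%N.

Lemma increasing_ltn n (i : 'I_n -> nat) : increasing i ->
  forall j k, (i j < i k)%N = (j < k)%N.
Proof.
move=> inc j k; case: (ltngtP j k) => [|/inc ltkj|/val_inj->]; last by rewrite ltnn.
  exact: inc.
by rewrite ltnNge ltnW.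
Qed.

(** An index cutoff selects an initial segment of positions, so the partial degree below it is a
    partial sum of gaps, hence a breakpoint. The witness is the first position reaching [N], or [n]
    if there is none. *)
Lemma increasing_downset n (i : 'I_n -> nat) N : increasing i ->
  exists2 p, (p <= n)%N & forall j, (i j < N)%N = (j < p)%N.
Proof.
move=> inc; case: (pickP (fun j => N <= i j)%N) => [j0 Nj0|noN]; last first.
  by exists n => // j; rewrite ltn_ord ltnNge noN.
case: (@arg_minnP _ j0 (fun j => N <= i j)%N (@nat_of_ord n) Nj0) => p Np minp.
exists p => [|j]; first exact: ltnW.
case: (ltnP j p) => [ltjp|lepj].
  by rewrite ltnNge; apply/negP=> /minp; rewrite leqNgt ltjp.
apply/negbTE; rewrite -leqNgt (leq_trans Np) //.
by rewrite leqNgt (increasing_ltn inc) -leqNgt.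
Qed.

(* The breakpoints of [S] are the partial degrees of any monomial of M_S. *)
Lemma index_monomial_sub S T (i : 'I_#|S|.+1 -> nat) (j : 'I_#|T|.+1 -> nat) :
  increasing i -> increasing j -> index_monomial i = index_monomial j ->
  S \subset T.
Proof.
move=> inci incj Em; apply/subsetP=> s; rewrite -!mem_breakpoints => Ss.
(* The last breakpoint is [d.+1], which exceeds [s.+1]; hence [s.+1] occurs earlier, at a valid
   argument of [i]. *)
have lts : (index s.+1 (breakpoints S) < #|S|.+1)%N.
  have := Ss; rewrite -index_mem size_breakpoints ltnS leq_eqVlt => /predU1P[E|//].
  have := nth_index 0%N Ss; rewrite E /= nth_rcons size_map -cardE ltnn eqxx.
  by rewrite ltnn => -[Ed]; have := ltn_ord s; rewrite -Ed ltnn.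
pose k := Ordinal lts.
(* The variables before [i k] carry the first [k] gaps of [S], of total [s.+1]; computed through
   [j], the same degree is a breakpoint of [T]. *)
have <- : (\sum_(n < i k) index_monomial i n = s.+1)%N.
  rewrite sum_index_monomial (eq_bigl (fun l : 'I__ => l < k)%N) => [|l].
    by rewrite sum_gap; [exact: nth_index | exact: ltnW].
  exact: increasing_ltn.
rewrite Em sum_index_monomial.
have [p lep /(_ _)/= Ep] := increasing_downset (i k) incj.
by rewrite (eq_bigl _ _ Ep) sum_gap // mem_nth // size_breakpoints.
Qed.

Lemma monomial_qsym_neq (R : pzSemiRingType) S T (i : 'I_#|S|.+1 -> nat) :
  increasing i -> T != S -> monomial_qsym R T (index_monomial i) = 0.
Proof.
move=> inci neTS; rewrite /monomial_qsym eq_card0 // => j; rewrite inE.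
apply: contraNF neTS => /andP[/forallP incj /eqP Ej].
have {}incj : increasing (fun l => val (j l)).
  by move=> l l' ltl; have /forallP/(_ l')/implyP := incj l; apply.
rewrite eqEsubset (index_monomial_sub incj inci Ej).
by rewrite (index_monomial_sub inci incj (esym Ej)).
Qed.

(** The identity sequence is itself counted, and a positive count stays nonzero in a numeric
    domain. *)
Lemma monomial_qsym_diag (R : numDomainType) S :
  monomial_qsym R S (index_monomial (fun j : 'I_#|S|.+1 => val j)) != 0.
Proof.
set m := index_monomial _.
have mP (j : 'I_#|S|.+1) : val j \in finsupp m.
  rewrite -cmE_neq0 index_monomialE (bigD1 j) //= eqxx mul1n -lt0n addn_gt0.
  by rewrite gap_gt0 // -ltnS.
rewrite pnatr_eq0 -lt0n; apply/card_gt0P.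
exists [ffun j => FSetSub (mP j)]; rewrite inE; apply/andP; split.
  by apply/forallP=> j; apply/forallP=> k; rewrite !ffunE; apply/implyP.
by apply/eqP; apply: eq_bigr => j _; rewrite ffunE.
Qed.

Lemma monomial_qsym_free (R : numDomainType) (a b : {set 'I_d} -> R) :
  (forall m, \sum_(T : {set 'I_d}) a T * monomial_qsym R T m =
             \sum_(T : {set 'I_d}) b T * monomial_qsym R T m) ->
  a =1 b.
Proof.
move=> eq_ab S.
have inc : increasing (fun j : 'I_#|S|.+1 => val j) by [].
have := eq_ab (index_monomial (fun j : 'I_#|S|.+1 => val j)).
rewrite (bigD1 S) //= big1 => [|T neTS]; last by rewrite monomial_qsym_neq ?mulr0.
rewrite [RHS](bigD1 S) //= big1 => [|T neTS]; last by rewrite monomial_qsym_neq ?mulr0.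
rewrite !addr0; apply: mulIf; exact: monomial_qsym_diag.
Qed.

End Breakpoints.

Theorem theorem3p2 (C : numClosedFieldType) (d : nat) (V : finType)
    (kappa : V -> 'I_d) (Phi : {set {set V}})
    (gT : finGroupType) (G : {group gT}) (to : action G V)
    (balPhi : balanced_relative_complex kappa Phi)
    (actPhi : acts_on_complex kappa Phi to) :
  [/\ (forall g, g \in G -> forall m : {cmonom nat},
        flag_hilb kappa Phi to C g m =
        \sum_(S : {set 'I_d})
          (\sum_(i < #|S|.+1)
             (-1) ^+ (#|S| - i) * homology_char actPhi C S i g)
          * fundamental_qsym C S m),
      (forall h : {set 'I_d} -> gT -> C,
        (forall g, g \in G -> forall m : {cmonom nat},
           flag_hilb kappa Phi to C g m =
           \sum_(S : {set 'I_d}) h S g * fundamental_qsym C S m) ->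
        forall (S : {set 'I_d}) g, g \in G ->
          h S g =
          \sum_(i < #|S|.+1)
             (-1) ^+ (#|S| - i) * homology_char actPhi C S i g)
    & (forall (S : {set 'I_d}) g, g \in G ->
        flag_h kappa Phi to C S g =
        \sum_(i < #|S|.+1)
           (-1) ^+ (#|S| - i) * homology_char actPhi C S i g)].
Proof.
have h_homology (S : {set 'I_d}) g : g \in G ->
    \sum_(i < #|S|.+1) (-1) ^+ (#|S| - i) * homology_char actPhi C S i g
    = flag_h kappa Phi to C S g.
  by move=> Gg; rewrite alternating_homology // sum_chain_char.
have hilbE g : g \in G -> forall m : {cmonom nat},
    flag_hilb kappa Phi to C g m =
    \sum_(S : {set 'I_d})
      (\sum_(i < #|S|.+1)
         (-1) ^+ (#|S| - i) * homology_char actPhi C S i g)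
      * fundamental_qsym C S m.
  move=> Gg m; rewrite flag_hilbE sum_fundamental_qsym.
  apply: eq_bigr => T _; congr (_ * _).
  under eq_bigr => S _ do rewrite h_homology //.
  exact/esym/(sum_moebius (fun U => (flag_f kappa Phi to U g)%:R)).
split=> // [h hilb_h S g Gg|S g Gg]; last by rewrite h_homology.
pose h' (T : {set 'I_d}) :=
  \sum_(i < #|T|.+1) (-1) ^+ (#|T| - i) * homology_char actPhi C T i g.
(* It suffices to compare subset sums, which are the M coefficients and so are determined by the
   series. *)
apply: (@sum_subsets_inj _ _ (h^~ g) h').
apply: monomial_qsym_free => m.
by rewrite -!sum_fundamental_qsym -hilb_h // hilbE.
Qed.
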